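(* Let $(X,g)$ be a compact zero-dimensional minimal system and consider $\tau_{\mathbb{N}}[g]$ as a monoid. Let $\mathcal{A}$ be the set of elements $h$ of $\tau_{\mathbb{N}}[g]$ that cannot be decomposed as $h=ab$ for $a,b\in\tau_{\mathbb{N}}[g]\smallsetminus\{1\}$. Define the support order on $\mathcal{A}$ by setting $h_1\le_{\mathrm{supp}}h_2$ if \[ C_{\mathcal{A}}(h_2)\subseteq C_{\mathcal{A}}(h_1)\cup\{h_2\},\quad\text{where } C_{\mathcal{A}}(h):=\{a\in\mathcal{A}\mid ah=ha\}. \] Then $(\mathcal{A},\le_{\mathrm{supp}})$ is a Boolean algebra with least element $\mathrm{id}_X$ and greatest element $g$, on which $\langle g\rangle$ acts by conjugation. Moreover, $\mathcal{A}$ is $\langle g\rangle$-equivariantly isomorphic to the set $\mathcal{CO}(X)$ of compact open subsets of $X$, ordered by inclusion.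
   Context: A homeomorphism $g$ of a Hausdorff space $X$ is minimal if $X\neq\emptyset$ and the only proper closed subset $K\subsetneq X$ with $gK\subseteq K$ is $K=\emptyset$. A compact minimal system $(X,g)$ is an infinite compact Hausdorff space $X$ with a minimal homeomorphism $g$ of $X$ (so $g$ is aperiodic); it is zero-dimensional if the compact open (equivalently, clopen) subsets of $X$ form a base for the topology. The topological full group $\tau[g]$ is the group of all homeomorphisms $h$ of $X$ for which there is a locally constant function $c:X\to\mathbb{Z}$ (unique, since $g$ is aperiodic) with $hx=g^{c(x)}x$ for all $x\in X$. An element $h\in\tau[g]$ is strongly positive if for every $y\in X$ with $hy\ne y$ we have $c(y)>0$; $\tau_{\mathbb{N}}[g]$ is the set of strongly positive elements of $\tau[g]$, a submonoid of $\tau[g]$. The group $\langle g\rangle$ acts on $\mathcal{CO}(X)$ by $A\mapsto gA$. *)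

(* Defs.v *)
From HB Require Import structures.
From mathcomp Require Import all_boot all_order all_algebra.
From mathcomp Require Import all_classical all_reals all_analysis.

Set Implicit Arguments.
Unset Strict Implicit.
Unset Printing Implicit Defensive.

Local Open Scope classical_set_scope.
Local Open Scope group_scope.

Record homeo (X : topologicalType) := Homeo {
  homeo_fun :> X -> X;
  homeo_inv : X -> X;
  homeo_funK : cancel homeo_fun homeo_inv;
  homeo_invK : cancel homeo_inv homeo_fun;
  homeo_fun_continuous : continuous homeo_fun;
  homeo_inv_continuous : continuous homeo_inv
}.

HB.instance Definition _ (X : topologicalType) := gen_eqMixin (homeo X).
HB.instance Definition _ (X : topologicalType) := gen_choiceMixin (homeo X).

Section HomeoGroup.
Variable X : topologicalType.
Implicit Types f g h : homeo X.

Lemma homeo_eq f g : (forall x, f x = g x) -> f = g.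
Proof.
case: f g => [f f' fK f'K cf cf'] [g g' gK g'K cg cg'] /= fg.
have {}fg : f = g by apply/funext.
subst g.
have ff' : f' = g' by apply/funext => x; rewrite -[x in LHS]g'K fK.
subst g'.
by congr Homeo; exact: Prop_irrelevance.
Qed.

Definition homeo_id : homeo X :=
  @Homeo X id id (fun=> erefl) (fun=> erefl) (fun=> cvg_id) (fun=> cvg_id).

Definition homeo_inverse f : homeo X :=
  Homeo (@homeo_invK _ f) (@homeo_funK _ f)
    (@homeo_inv_continuous _ f) (@homeo_fun_continuous _ f).

Lemma comp_continuous (u v : X -> X) :
  continuous u -> continuous v -> continuous (u \o v).
Proof. by move=> cu cv x; apply: continuous_comp; [exact: cv|exact: cu]. Qed.

(* Left actions: the product f * g maps x to f (g x). *)
Definition homeo_comp f g : homeo X :=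
  @Homeo X (homeo_fun f \o homeo_fun g) (homeo_inv g \o homeo_inv f)
    (can_comp (@homeo_funK _ f) (@homeo_funK _ g))
    (can_comp (@homeo_invK _ g) (@homeo_invK _ f))
    (comp_continuous (@homeo_fun_continuous _ f) (@homeo_fun_continuous _ g))
    (comp_continuous (@homeo_inv_continuous _ g) (@homeo_inv_continuous _ f)).

Lemma homeo_compA : associative homeo_comp.
Proof. by move=> f g h; apply: homeo_eq. Qed.

Lemma homeo_comp1l : left_id homeo_id homeo_comp.
Proof. by move=> f; apply: homeo_eq. Qed.

Lemma homeo_comp1r : right_id homeo_id homeo_comp.
Proof. by move=> f; apply: homeo_eq. Qed.

Lemma homeo_compVl : left_inverse homeo_id homeo_inverse homeo_comp.
Proof. by move=> f; apply: homeo_eq => x; exact: homeo_funK. Qed.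

Lemma homeo_compVr : right_inverse homeo_id homeo_inverse homeo_comp.
Proof. by move=> f; apply: homeo_eq => x; exact: homeo_invK. Qed.

End HomeoGroup.

HB.instance Definition _ (X : topologicalType) :=
  isGroup.Build (homeo X) (@homeo_compA X) (@homeo_comp1l X) (@homeo_comp1r X)
    (@homeo_compVl X) (@homeo_compVr X).

Definition expgz (G : groupType) (g : G) (n : int) : G :=
  match n with Posz m => g ^+ m | Negz m => g ^- m.+1 end.

(* The cyclic subgroup <g>; the notation <[g]> of MathComp is for finite groups. *)
Definition cyclic_subgroup (G : groupType) (g : G) : set G := range (expgz g).

Definition minimal_homeo (X : topologicalType) (g : homeo X) : Prop :=
  [set: X] !=set0 /\
  forall K : set X, closed K -> K <> setT -> g @` K `<=` K -> K = set0.

Definition compact_minimal_system (X : topologicalType) (g : homeo X) : Prop :=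
  [/\ infinite_set [set: X], compact [set: X], hausdorff_space X
    & minimal_homeo g].

Definition compact_opens (X : topologicalType) : set (set X) :=
  [set U | compact U /\ open U].

(* The library's zero_dimensional only asks clopen sets to separate points. *)
Definition zero_dimensional_space (X : topologicalType) : Prop :=
  basis (@compact_opens X).

Definition is_cocycle (X : topologicalType) (g h : homeo X) (c : X -> int) :=
  (forall x, \forall y \near x, c y = c x) /\ forall x, h x = expgz g (c x) x.

Definition topological_full_group (X : topologicalType) (g : homeo X) :
  set (homeo X) := [set h | exists c, is_cocycle g h c].

Definition strongly_positive (X : topologicalType) (g : homeo X) :
  set (homeo X) :=
  [set h | topological_full_group g h /\
    exists2 c, is_cocycle g h c & forall y, h y <> y -> (0 < c y)%R].

Definition indecomposable (G : groupType) (M : set G) : set G :=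
  [set h | M h /\ ~ exists a b, [/\ (M `\ 1) a, (M `\ 1) b & h = a * b]].

Definition irreducibles (X : topologicalType) (g : homeo X) : set (homeo X) :=
  indecomposable (strongly_positive g).

Definition centralizer_in (G : groupType) (A : set G) (h : G) : set G :=
  [set a | A a /\ a * h = h * a].

Definition supp_le (X : topologicalType) (g h1 h2 : homeo X) : Prop :=
  centralizer_in (irreducibles g) h2 `<=` centralizer_in (irreducibles g) h1 `|` [set h2].

(* The relation le on A is the order of a (possibly degenerate) Boolean algebra
   structure with carrier A, whose bottom and top are bot and top. *)
Definition is_boolean_algebra (T : Type) (A : set T) (le : T -> T -> Prop)
    (bot top : T) : Prop :=
  exists (d : Order.disp_t) (c : Order.CTBDistrLattice d {x : T | A x}),
    let B : ctbDistrLatticeType d := Order.CTBDistrLattice.Pack c in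
    [/\ forall x y : B, (x <= y)%O <-> le (sval x) (sval y),
        sval (\bot%O : B) = bot & sval (\top%O : B) = top].

Definition conj_by (G : groupType) (k h : G) : G := k * h * k^-1.

(* Main.v *)
(* For a clopen U let g_U be the first return map of g to U, extended by the
   identity off U. A strongly positive h with support U jumps, at each point of
   U, at least to the next visit to U, so h = g_U b with b strongly positive;
   hence an irreducible h equals g_U. Conversely, if g_U = ab, the jump of b at a
   point of U is 0 or the full return time, so the support of b is g_U-invariant
   and, g_U being minimal on U, it is empty or U; so g_U is irreducible. By the
   same invariance argument g_U and g_V commute iff U = V or U and V are
   disjoint. Since X has no isolated points this turns the support order into
   inclusion of supports, and h |-> support h is the required isomorphism. *)
From HB Require Import structures.
Require Import Defs.
From mathcomp Require Import all_boot all_order all_algebra.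
From mathcomp Require Import all_classical all_reals all_analysis.
From mathcomp Require Import zify.

Set Implicit Arguments.
Unset Strict Implicit.
Unset Printing Implicit Defensive.

Local Open Scope classical_set_scope.
Local Open Scope group_scope.

(** * Boolean algebra structures carried over from fields of sets *)

(** The operations of the field of sets [C] are pulled back along [phi]; since [phi] is injective on
    [A], every lattice law can be checked after applying it, where it becomes a set identity. *)
Lemma is_boolean_algebra_set_bij (T X : Type) (A : set T) (C : set (set X))
    (phi : T -> set X) (le : T -> T -> Prop) (bot top : T) :
  set_bij A C phi ->
  C set0 -> (forall U, C U -> C (~` U)) -> (forall U V, C U -> C V -> C (U `&` V)) ->
  (forall x y, A x -> A y -> (le x y <-> phi x `<=` phi y)) ->
  A bot -> phi bot = set0 -> A top -> phi top = setT ->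
  is_boolean_algebra A le bot top.
Proof.
move=> [AC phiI CA] C0 Cc CI leP Abot phibot Atop phitop.
pose B := {x : T | A x}; pose f (b : B) := phi (sval b).
have Cf b : C (f b) by apply: AC; exact: (svalP b).
have fI : injective f.
  move=> [a Aa] [b Ab] /= fab; apply: eq_exist => /=.
  by apply: phiI => //; rewrite inE.
have bot_top : f (exist _ bot Abot) = set0 /\ f (exist _ top Atop) = setT by [].
(* A chosen preimage for every set; outside [C] the condition is void and the bottom element serves
   as default. *)
have finv U : {b : B | C U -> f b = U}.
  apply: cid; have [CU|nCU] := pselect (C U); last by exists (exist _ bot Abot).
  by have [a Aa <-] := CA _ CU; exists (exist _ a Aa).
pose s U := sval (finv U).
have fs U : C U -> f (s U) = U by exact: (svalP (finv U)).
have CU U V : C U -> C V -> C (U `|` V).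
  by move=> CU CV; rewrite -[_ `|` _]setCK setCU; exact: Cc (CI _ _ (Cc _ _) (Cc _ _)).
pose leB (a b : B) := `[< f a `<=` f b >].
pose meetB a b := s (f a `&` f b).
pose joinB a b := s (f a `|` f b).
pose complB a := s (~` f a).
have fmeet a b : f (meetB a b) = f a `&` f b by rewrite fs//; exact: CI.
have fjoin a b : f (joinB a b) = f a `|` f b by rewrite fs//; exact: CU.
have fcompl a : f (complB a) = ~` f a by rewrite fs//; exact: Cc.
pose Bc : choiceType := HB.pack B (gen_eqMixin B) (gen_choiceMixin B).
pose ltB (a b : Bc) := (b != a) && leB a b.
have le_def (a b : Bc) : leB a b = (meetB a b == a :> Bc).
  apply/asboolP/eqP => [/setIidPl fab|<-]; first by apply: fI; rewrite fmeet.
  by rewrite fmeet; exact: subIsetr.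
have lt_def (a b : Bc) : ltB a b = (b != a) && leB a b by [].
have meetC : commutative meetB by move=> a b; apply: fI; rewrite !fmeet setIC.
have joinC : commutative joinB by move=> a b; apply: fI; rewrite !fjoin setUC.
have meetA : associative meetB by move=> a b c; apply: fI; rewrite !fmeet setIA.
have joinA : associative joinB by move=> a b c; apply: fI; rewrite !fjoin setUA.
have joinKI b a : meetB a (joinB a b) = a by apply: fI; rewrite fmeet fjoin setUC setKU.
have meetKU b a : joinB a (meetB a b) = a by apply: fI; rewrite fjoin fmeet setIC setKI.
have meetUl : left_distributive meetB joinB.
  by move=> a b c; apply: fI; rewrite fmeet !fjoin !fmeet setIUl.
have meetxx : idempotent_op meetB by move=> a; apply: fI; rewrite fmeet setIid.
pose d := set_display.
pose D : distrLatticeType d := HB.pack Bc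
  (@Order.isMeetJoinDistrLattice.Build d Bc _ _ _ _
    le_def lt_def meetC joinC meetA joinA joinKI meetKU meetUl meetxx).
have le0 (x : D) : (exist _ bot Abot <= x :> D)%O.
  by apply/asboolP; rewrite bot_top.1.
have le1 (x : D) : (x <= exist _ top Atop :> D)%O.
  by apply/asboolP; rewrite bot_top.2.
pose TB : tbDistrLatticeType d := HB.pack D
  (@Order.hasBottom.Build d D _ le0) (@Order.hasTop.Build d D _ le1).
have joinxC (x : TB) : (Order.join x (complB x) = \top)%O.
  by apply: fI; rewrite fjoin fcompl setUv bot_top.2.
have meetxC (x : TB) : (Order.meet x (complB x) = \bot)%O.
  by apply: fI; rewrite fmeet fcompl setICr bot_top.1.
pose CTB : ctbDistrLatticeType d := HB.pack TB
  (@Order.TBDistrLattice_hasComplement.Build d TB complB joinxC meetxC).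
exists d, (Order.CTBDistrLattice.class CTB); split=> // x y.
apply: iff_trans (iff_sym (leP _ _ (svalP x) (svalP y))).
exact: iff_sym (rwP (asboolP _)).
Qed.

(** * Pointwise evaluation of products, inverses and iterates *)

Lemma homeo_mulE (X : topologicalType) (f h : homeo X) (x : X) :
  (f * h) x = f (h x).
Proof. by []. Qed.

Lemma homeo_invE (X : topologicalType) (f : homeo X) (x : X) :
  f^-1 x = homeo_inv f x.
Proof. by []. Qed.

Lemma homeo_inj (X : topologicalType) (f : homeo X) : injective f.
Proof. exact: can_inj (@homeo_funK _ f). Qed.

Lemma homeo_expE (X : topologicalType) (f : homeo X) (n : nat) (x : X) :
  (f ^+ n) x = iter n f x.
Proof. by elim: n => // n IH; rewrite expgS homeo_mulE IH. Qed.

Lemma continuous_iter (X : topologicalType) (f : X -> X) (n : nat) :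
  continuous f -> continuous (iter n f).
Proof.
by move=> cf; elim: n => [|n IH] x; [exact: cvg_id|exact: comp_continuous].
Qed.

Lemma iterK (T : Type) (f f' : T -> T) (n : nat) :
  cancel f f' -> cancel (iter n f) (iter n f').
Proof. by move=> fK; elim: n => // n IH x; rewrite iterSr iterS fK IH. Qed.

Lemma iter_subK (T : Type) (f f' : T -> T) (i n : nat) (x : T) :
  cancel f f' -> (i <= n)%N -> iter i f' (iter n f x) = iter (n - i) f x.
Proof. by move=> fK lein; rewrite -{1}(subnKC lein) iterD iterK. Qed.

(** * Return times and first return maps *)

Definition return_time (T : Type) (f : T -> T) (U : set T) (x : T) (n : nat) :=
  [/\ (0 < n)%N, U (iter n f x) &
      forall i, (0 < i < n)%N -> ~ U (iter i f x)].

Lemma return_time_ex (T : Type) (f : T -> T) (U : set T) (x : T) (n : nat) :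
  (0 < n)%N -> U (iter n f x) -> exists m, return_time f U x m.
Proof.
move=> n0 Un; have ex : exists n, (0 < n)%N && `[< U (iter n f x) >].
  by exists n; rewrite n0; apply/asboolP.
case: (ex_minnP ex) => m /andP[m0 /asboolP Um] mmin; exists m; split => // i.
move=> /andP[i0 im] Ui; have := mmin i; rewrite i0 leqNgt im /= => nUi.
by have /nUi : `[< U (iter i f x) >] by apply/asboolP.
Qed.

Lemma return_time_unique (T : Type) (f : T -> T) (U : set T) (x : T) (m n : nat) :
  return_time f U x m -> return_time f U x n -> m = n.
Proof.
move=> [m0 Um mmin] [n0 Un nmin]; case: (ltngtP m n) => // mn.
  by case: (nmin m); rewrite ?m0.
by case: (mmin n); rewrite ?n0.
Qed.

(** The points strictly between [x] and its return are the same in both directions, met in opposite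
    order. This is what makes the return map of the inverse invert the return map. *)
Lemma return_time_reverse (T : Type) (f f' : T -> T) (U : set T) (x : T) (n : nat) :
  cancel f f' -> U x -> return_time f U x n -> return_time f' U (iter n f x) n.
Proof.
move=> fK Ux [n0 Un nmin]; split=> // [|i /andP[i0 ltin]]; first by rewrite iterK.
by rewrite (iter_subK _ fK (ltnW ltin)); apply: nmin; lia.
Qed.

(* The value 0 off U encodes that the return map is the identity there. *)
Definition first_return (T : Type) (f : T -> T) (U : set T) (x : T) : nat :=
  if `[< U x >] then xget 0%N (return_time f U x) else 0%N.

Lemma first_return_out (T : Type) (f : T -> T) (U : set T) (x : T) :
  ~ U x -> first_return f U x = 0%N.
Proof. by move=> nUx; rewrite /first_return asboolF. Qed.

Lemma first_returnE (T : Type) (f : T -> T) (U : set T) (x : T) (n : nat) :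
  U x -> return_time f U x n -> first_return f U x = n.
Proof.
move=> Ux rn; rewrite /first_return asboolT//; case: xgetP => [m _ rm|nr].
  exact: return_time_unique rm rn.
by case: (nr n).
Qed.

(** Time 0 is allowed, so a positive return time from [x] is obtained by applying this at [f x]. *)
Definition recurrent (T : Type) (f : T -> T) (U : set T) :=
  forall x, exists n, U (iter n f x).

Lemma recurrent_first_return (T : Type) (f : T -> T) (U : set T) (x : T) :
  recurrent f U -> U x -> return_time f U x (first_return f U x).
Proof.
move=> rec Ux; have [n] := rec (f x); rewrite -iterSr => Un.
have [m rm] := return_time_ex (ltn0Sn n) Un.
by rewrite (first_returnE Ux rm).
Qed.

Definition return_map (T : Type) (f : T -> T) (U : set T) (x : T) : T :=
  iter (first_return f U x) f x.

(** Recurrence is asked only when [U] has a point, because the empty set is recurrent in no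
    inhabited space; its return map is the identity. *)
Lemma return_mapK (T : Type) (f f' : T -> T) (U : set T) :
  cancel f f' -> (forall x, U x -> recurrent f U) ->
  cancel (return_map f U) (return_map f' U).
Proof.
move=> fK rec x; have [Ux|nUx] := pselect (U x); last first.
  by rewrite /return_map (first_return_out f)//= first_return_out.
have rx := recurrent_first_return (rec _ Ux) Ux.
have rev := return_time_reverse fK Ux rx.
rewrite /return_map (first_returnE _ rev) ?iterK//; by case: rx.
Qed.

(** * Local constancy of return times *)

Definition locally_constant (X : topologicalType) (T : Type) (c : X -> T) :=
  forall x, \forall y \near x, c y = c x.

Lemma near_comp (X Y : topologicalType) (f : X -> Y) (P : set Y) (x : X) :
  {for x, continuous f} -> (\forall y \near f x, P y) ->
  \forall z \near x, P (f z).
Proof. by move=> cf; exact: cf. Qed.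

Lemma near_open (X : topologicalType) (U : set X) (x : X) :
  open U -> U x -> \forall y \near x, U y.
Proof. by move=> oU Ux; apply: open_nbhs_nbhs. Qed.

Lemma open_locally_constant (X : topologicalType) (T : Type) (c : X -> T)
    (P : set T) :
  locally_constant c -> open [set x | P (c x)].
Proof.
by move=> lc; rewrite openE => x /= Px; apply: filterS (lc x) => y /= ->.
Qed.

Lemma locally_constant_iter (X : topologicalType) (f : X -> X) (c : X -> nat) :
  continuous f -> locally_constant c ->
  continuous (fun x => iter (c x) f x).
Proof.
move=> cf lc x A nA.
have ci := @continuous_iter _ f (c x) cf x.
by apply: filterS2 (lc x) (ci A nA) => y /= -> .
Qed.

(** That the return time at [x] equals [n] is expressed by finitely many conditions placing iterates
    in [U] or in its complement; both are open, so the conditions persist near [x]. *)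
Lemma locally_constant_first_return (X : topologicalType) (f : X -> X)
    (U : set X) :
  continuous f -> clopen U -> (forall x, U x -> recurrent f U) ->
  locally_constant (first_return f U).
Proof.
move=> cf [oU cU] rec x; have oC : open (~` U) by exact: closed_openC.
have [Ux|nUx] := pselect (U x); last first.
  rewrite first_return_out//; apply: filterS (near_open oC nUx) => y.
  exact: first_return_out.
have [] := recurrent_first_return (rec _ Ux) Ux.
set n := first_return f U x => n0 Un nmin.
have Uy : \forall y \near x, U y by exact: near_open.
have Uny : \forall y \near x, U (iter n f y).
  by apply: near_comp; [exact: continuous_iter|exact: near_open].
(* Indexing the times by ['I_n] makes this a finite conjunction, which a filter respects. *)
have nUy : \forall y \near x, forall i : 'I_n, (0 < i)%N -> ~ U (iter i f y).
  apply: filter_forall => i; have [->|i0] := posnP i.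
    exact: nearW.
  have : \forall y \near x, ~ U (iter i f y).
    apply: (near_comp (P := ~` U)); first exact: continuous_iter.
    by apply: near_open => //; apply: nmin; rewrite i0 ltn_ord.
  exact: filterS.
near=> y; apply: first_returnE; first by near: y.
split=> //; first by near: y.
move=> i /andP[i0 ltin]; have /(_ (Ordinal ltin) i0)// :
  forall i : 'I_n, (0 < i)%N -> ~ U (iter i f y) by near: y.
Unshelve. all: by end_near. Qed.

(** * Supports, conjugation and commutation *)

Definition support (X : topologicalType) (h : homeo X) : set X :=
  [set x | h x <> x].

Lemma support_stable (X : topologicalType) (h : homeo X) (x : X) :
  support h (h x) <-> support h x.
Proof.
by split=> hx; [move=> fx; apply: hx; rewrite !fx|move=> /homeo_inj].
Qed.

Lemma support_eq0 (X : topologicalType) (h : homeo X) : support h = set0 -> h = 1.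
Proof.
move=> s0; apply: homeo_eq => x; apply: contrapT => hx.
by have : support h x by []; rewrite s0.
Qed.

Lemma support_conj (X : topologicalType) (k h : homeo X) :
  support (conj_by k h) = k @` support h.
Proof.
apply/seteqP; split=> [x hx|_ [x hx <-]].
  exists (homeo_inv k x); last exact: homeo_invK.
  by move=> e; apply: hx; rewrite /conj_by !homeo_mulE homeo_invE e homeo_invK.
move=> e; apply: hx; apply: (@homeo_inj _ k); move: e.
by rewrite /conj_by !homeo_mulE homeo_invE homeo_funK.
Qed.

Lemma commute_disjoint_support (X : topologicalType) (h1 h2 : homeo X) :
  (forall x, support h1 x -> ~ support h2 x) -> h1 * h2 = h2 * h1.
Proof.
move=> dis; apply: homeo_eq => x; rewrite !homeo_mulE.
have [h1x|/contrapT h1x] := pselect (h1 x <> x).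
  have /contrapT -> := dis _ h1x.
  by have /contrapT -> := dis _ ((support_stable _ _).2 h1x).
rewrite h1x; have [h2x|/contrapT -> //] := pselect (h2 x <> x).
apply: contrapT => s1.
by apply: (dis (h2 x)) => //; apply/support_stable.
Qed.

Lemma commute_stable_support (X : topologicalType) (h1 h2 : homeo X) (x : X) :
  h1 * h2 = h2 * h1 -> support h2 x -> support h2 (h1 x).
Proof.
move=> hC h2x h2h1x; apply: h2x; apply: (@homeo_inj _ h1).
by rewrite -[RHS]h2h1x -!homeo_mulE hC.
Qed.

(** * Recurrence and aperiodicity of minimal homeomorphisms *)

(** The points whose forward orbit never enters [U] form a closed forward-invariant set that misses
    [U], so minimality empties it. *)
Lemma minimal_recurrent (X : topologicalType) (g : homeo X) (U : set X) :
  minimal_homeo g -> open U -> U !=set0 -> recurrent g U.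
Proof.
move=> [_ gmin] oU [u Uu] x.
pose K := [set y | forall n, ~ U (iter n g y)].
have cK : closed K.
  have -> : K = \bigcap_(n in setT) (iter n g @^-1` ~` U).
    by apply/seteqP; split=> y Ky n; [move=> _; exact: Ky|exact: (Ky n I)].
  apply: closed_bigI => n _; apply: closed_comp; last exact: open_closedC.
  by move=> y _; apply: continuous_iter; exact: homeo_fun_continuous.
have K0 : K = set0.
  apply: gmin => // [KT|_ [y Ky <-] n]; last by rewrite -iterSr; exact: Ky.
  by have /(_ 0%N) : K u by rewrite KT.
apply: contrapT => nx; have : K x by move=> n Un; apply: nx; exists n.
by rewrite K0.
Qed.

(* Compactness bounds the hitting times, so pulling a point back far enough
   forces its backward orbit to hit as well. *)
Lemma minimal_homeoV (X : topologicalType) (g : homeo X) :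
  compact [set: X] -> minimal_homeo g -> minimal_homeo g^-1.
Proof.
move=> cX gmin; split=> [|K cK KT gK]; first by case: gmin.
have KC0 : ~` K !=set0.
  by apply/set0P/negP => /eqP K0; apply: KT; rewrite -[K]setCK K0 setC0.
have oKC : open (~` K) by exact: closed_openC.
have rec := minimal_recurrent gmin oKC KC0.
pose hit N y := exists2 n, (n <= N)%N & (~` K) (iter n g y).
have [N _ /(_ N (leqnn N)) hitN] : \forall N \near \oo, [set: X] `<=` hit N.
  apply: (compact_near_coveringP _).1 cX _ _ _ _ _ => x _.
  have [n nK] := rec x; exists (iter n g @^-1` ~` K, [set N | (n <= N)%N]).
    split; last by exists n.
    apply: near_comp; last exact: near_open.
    by apply: continuous_iter; exact: homeo_fun_continuous.
  by move=> [y N] /= [Ky nN]; exists n.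
apply: contrapT => /eqP/set0P[x Kx].
have KV n : K (iter n (homeo_inv g) x).
  by elim: n => // n Kn; apply: gK; exists (iter n (homeo_inv g) x).
have [n nN] := hitN (iter N (homeo_inv g) x) I.
by rewrite (iter_subK _ (@homeo_invK _ g) nN); apply; exact: KV.
Qed.

(** A periodic orbit is finite, hence closed, and it is invariant and nonempty; minimality would
    make it all of the infinite space [X]. *)
Lemma minimal_aperiodic (X : topologicalType) (g : homeo X) (n : nat) (x : X) :
  compact_minimal_system g -> iter n g x = x -> n = 0%N.
Proof.
move=> [infX cX hX [_ gmin]] gx; case: n => // n in gx *; exfalso.
pose K := (fun i => iter i g x) @` `I_n.+1.
have finK : finite_set K by exact/finite_image/finite_II.
have cK : closed K.
  by have /accessible_finite_set_closed := hausdorff_accessible hX; exact.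
have [KT|KT] := pselect (K = setT); first by apply: infX; rewrite -KT.
have : K x by exists 0%N.
rewrite (gmin K)// => _ [_ [i /= ltin <-] <-]; rewrite -iterS.
move: ltin; rewrite leq_eqVlt => /orP[/eqP[->]|ltin]; last by exists i.+1.
by rewrite gx; exists 0%N.
Qed.

Lemma iter_aperiodic (X : topologicalType) (g : homeo X) (m n : nat) (x : X) :
  compact_minimal_system g -> iter m g x = iter n g x -> m = n.
Proof.
move=> Xmin.
wlog lemn : m n / (m <= n)%N.
  move=> H; have [/H//|/ltnW nm e] := leqP m n; exact/esym/H.
move=> /(congr1 (iter m (homeo_inv g))).
rewrite (iterK _ (@homeo_funK _ g)) (iter_subK _ (@homeo_funK _ g) lemn).
by move=> /esym/(minimal_aperiodic Xmin); lia.
Qed.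

(** * Strongly positive elements, return maps and irreducibles *)

Section MinimalSystem.
Variables (X : topologicalType) (g : homeo X).
Hypothesis Xmin : compact_minimal_system g.
Implicit Types (h : homeo X) (U : set X) (x : X).

(** A negative cocycle value could occur only at a fixed point of [h], which would then be periodic
    for [g]. So cocycles may be taken in the natural numbers and powers replaced by iterates. *)
Lemma strongly_positiveP h :
  strongly_positive g h <->
  exists2 c : X -> nat, locally_constant c & forall x, h x = iter (c x) g x.
Proof.
split=> [[_ [c [lc hc] cpos]]|[c lc hc]].
  exists (fun x => absz (c x)) => x; first by apply: filterS (lc x) => y ->.
  rewrite hc; have := cpos x; rewrite hc.
  case: (c x) => n /=; first by rewrite homeo_expE.
  move=> npos; exfalso; have /contrapT gx : ~ (g ^- n.+1) x <> x by move/npos.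
  suff : n.+1 = 0%N by [].
  apply: (minimal_aperiodic (x := x) Xmin).
  by rewrite -homeo_expE -[in LHS]gx homeo_invE homeo_invK.
have cc : is_cocycle g h (fun x => Posz (c x)).
  by split=> x; [apply: filterS (lc x) => y ->|rewrite hc -homeo_expE].
split; first by exists (fun x => Posz (c x)).
exists (fun x => Posz (c x)) => // y; rewrite hc.
by case: (c y).
Qed.

Lemma cocycle_supportE h (c : X -> nat) x :
  (forall x, h x = iter (c x) g x) -> support h x <-> (0 < c x)%N.
Proof.
move=> hc; rewrite /support /= hc lt0n; split=> [gx|/eqP c0 gx].
  by apply/eqP => c0; apply: gx; rewrite c0.
exact/c0/(minimal_aperiodic Xmin gx).
Qed.

Lemma strongly_positive_clopen_support h :
  strongly_positive g h -> clopen (support h).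
Proof.
move=> /strongly_positiveP[c lc hc].
have -> : support h = [set x | (0 < c x)%N].
  by apply/seteqP; split=> x /(cocycle_supportE _ hc).
split; first exact: (@open_locally_constant _ _ c [set n | (0 < n)%N] lc).
rewrite -[X in closed X]setCK; apply: open_closedC.
exact: (@open_locally_constant _ _ c [set n | ~ (0 < n)%N] lc).
Qed.

Lemma clopen_recurrent U x : clopen U -> U x -> recurrent g U.
Proof.
move=> [oU _] Ux; have [_ _ _ gmin] := Xmin.
by apply: minimal_recurrent => //; exists x.
Qed.

Lemma clopen_recurrentV U x : clopen U -> U x -> recurrent (homeo_inv g) U.
Proof.
move=> [oU _] Ux; have [_ cX _ gmin] := Xmin.
by apply: (minimal_recurrent (minimal_homeoV cX gmin)) => //; exists x.
Qed.

Lemma return_map_homeo U : clopen U ->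
  exists2 r : homeo X, r =1 return_map g U &
    homeo_inv r =1 return_map (homeo_inv g) U.
Proof.
move=> coU; have rec := clopen_recurrent coU; have recV := clopen_recurrentV coU.
have ct : continuous (return_map g U).
  apply: locally_constant_iter; first exact: homeo_fun_continuous.
  by apply: locally_constant_first_return => //; exact: homeo_fun_continuous.
have ctV : continuous (return_map (homeo_inv g) U).
  apply: locally_constant_iter; first exact: homeo_inv_continuous.
  by apply: locally_constant_first_return => //; exact: homeo_inv_continuous.
by exists (Homeo (return_mapK (@homeo_funK _ g) rec)
  (return_mapK (@homeo_invK _ g) recV) ct ctV).
Qed.

Lemma return_map_strongly_positive U h :
  clopen U -> h =1 return_map g U -> strongly_positive g h.
Proof.
move=> coU hU; apply/strongly_positiveP; exists (first_return g U) => //.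
apply: locally_constant_first_return => //; first exact: homeo_fun_continuous.
by move=> x; exact: clopen_recurrent.
Qed.

Lemma return_map_support U h :
  clopen U -> h =1 return_map g U -> support h = U.
Proof.
move=> coU hU; apply/seteqP; split=> x.
  move=> /(cocycle_supportE _ hU); apply: contraPP => nUx.
  by rewrite first_return_out.
move=> Ux; apply/(cocycle_supportE _ hU).
by have [] := recurrent_first_return (clopen_recurrent coU Ux) Ux.
Qed.

(* If h has cocycle c, the backward return time at [h x] is at most [c x],
   because x itself lies in the support. *)
Lemma strongly_positive_divisible h :
  strongly_positive g h ->
  exists r b : homeo X, [/\ r =1 return_map g (support h),
    strongly_positive g b & h = r * b].
Proof.
move=> hpos; have coU := strongly_positive_clopen_support hpos.
have [r rE rV] := return_map_homeo coU.
have [c lc hc] := (strongly_positiveP _).1 hpos.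
exists r, (r^-1 * h); split=> //; last by rewrite mulVKg.
apply/strongly_positiveP.
pose m := first_return (homeo_inv g) (support h).
have lm : locally_constant m.
  apply: locally_constant_first_return => //; first exact: homeo_inv_continuous.
  by move=> x; exact: clopen_recurrentV.
exists (fun x => c x - m (h x))%N => x.
  have lmh : \forall y \near x, m (h y) = m (h x).
    by apply: near_comp (lm _); exact: homeo_fun_continuous.
  by apply: filterS2 (lc x) lmh => y /= -> ->.
rewrite homeo_mulE homeo_invE rV /return_map -/(m _).
rewrite {2}hc (iter_subK _ (@homeo_funK _ g))//.
have [hx|nhx] := pselect (support h x); last first.
  by rewrite /m first_return_out// => /support_stable.
have hhx := (support_stable h x).2 hx.
have [_ _ mmin] := recurrent_first_return (clopen_recurrentV coU hhx) hhx.
rewrite leqNgt; apply/negP => ltcm; apply: (mmin (c x)).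
  by rewrite ltcm andbT; exact/(cocycle_supportE _ hc).
by rewrite hc (iterK _ (@homeo_funK _ g)).
Qed.

(** The first return map inherits minimality from [g]: an orbit starting in [K] would reach the open
    set of points of [U] outside [K], but its visits to [U] are exactly the successive images under
    [h], which stay in [K]. *)
Lemma return_map_minimal U K h :
  clopen U -> h =1 return_map g U -> K `<=` U -> open (U `\` K) ->
  (forall x, K x -> K (h x)) -> K !=set0 -> U `<=` K.
Proof.
move=> coU hU KU oUK Kh [x Kx] y Uy; apply: contrapT => nKy.
have [_ _ _ gmin] := Xmin.
have [|n [Un nKn]] := minimal_recurrent gmin oUK _ x; first by exists y.
(* Induction on the hitting time: the first return from [x] occurs no later than time [n.+1], so
   passing from [x] to [h x] shortens the remaining time strictly. *)
apply: nKn; elim/ltn_ind: n x Kx Un => -[//|n] IH x Kx Un.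
have Ux := KU _ Kx; have rec := clopen_recurrent coU Ux.
have [r0 Ur rmin] := recurrent_first_return rec Ux.
have lern : (first_return g U x <= n.+1)%N.
  by rewrite leqNgt; apply/negP => lt; apply: rmin Un.
rewrite -(subnK lern) iterD -/(return_map g U x) -hU; apply: IH.
- lia.
- exact: Kh.
- by rewrite hU /return_map -iterD subnK.
Qed.

Lemma mul_cocycle (a b : homeo X) (ca cb : X -> nat) x :
  (forall x, a x = iter (ca x) g x) -> (forall x, b x = iter (cb x) g x) ->
  (a * b) x = iter (ca (b x) + cb x) g x.
Proof. by move=> ac bc; rewrite homeo_mulE ac bc iterD. Qed.

Lemma return_map_irreducible U h :
  clopen U -> h =1 return_map g U -> irreducibles g h.
Proof.
move=> coU hU; split; first exact: return_map_strongly_positive hU.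
move=> [a [b [[apos a1] [bpos b1] hab]]].
have [ca lca ac] := (strongly_positiveP _).1 apos.
have [cb lcb bc] := (strongly_positiveP _).1 bpos.
have rE x : first_return g U x = (ca (b x) + cb x)%N.
  apply: (iter_aperiodic (x := x) Xmin).
  by rewrite -(mul_cocycle _ ac bc) -hab hU.
pose K := support b.
have KU : K `<=` U.
  move=> x /(cocycle_supportE _ bc); apply: contraPP => nUx.
  by have := rE x; rewrite first_return_out//; lia.
(* After [cb x] steps the orbit is at [b x], a point of [U]; if [a] moved it further, this visit
   would precede the first return. *)
have Kr x : K x -> cb x = first_return g U x.
  move=> Kx; have Ux := KU _ Kx.
  have [_ _ rmin] := recurrent_first_return (clopen_recurrent coU Ux) Ux.
  have := rE x; have /(cocycle_supportE _ bc) cb0 := Kx.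
  case: (posnP (ca (b x))) => [->//|ca0] e; exfalso.
  apply: (rmin (cb x)); first lia.
  by rewrite -bc; apply: KU; apply/support_stable.
have Kh x : K x -> K (h x).
  by move=> Kx; rewrite hU /return_map -Kr// -bc; apply/support_stable.
have K0 : K !=set0 by apply/set0P/eqP => /support_eq0.
have oUK : open (U `\` K).
  have [_ cK] := strongly_positive_clopen_support bpos.
  by rewrite setDE; apply: openI; [case: coU|exact: closed_openC].
have UK := return_map_minimal coU hU KU oUK Kh K0.
(* On [U], which is contained in [K], the factor [b] makes the whole return jump; off [U] the two
   jumps add up to 0, so both vanish. Cancelling [b] then forces [a] to be 1. *)
have hb : h = b.
  apply: homeo_eq => x; rewrite hU bc /return_map.
  have [/UK/Kr -> //|nUx] := pselect (U x).
  have := rE x; rewrite first_return_out// => /esym/eqP.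
  by rewrite addn_eq0 => /andP[_ /eqP->].
by apply: a1; apply: (mulIg b); rewrite mul1g -hab.
Qed.

Lemma irreducible_return_map h :
  irreducibles g h -> h =1 return_map g (support h).
Proof.
move=> [hpos hirr]; have [r [b [rE bpos hrb]]] := strongly_positive_divisible hpos.
have coU := strongly_positive_clopen_support hpos.
have rpos := return_map_strongly_positive coU rE.
have [b1|b1] := pselect (b = 1); first by rewrite {1}hrb b1 mulg1.
(* If [r] is trivial, then so is the support of [h], which is also the support of [r]; hence [h] is
   1 and agrees with [r]. *)
have [r1|r1] := pselect (r = 1); last by case: hirr; exists r, b.
suff h1 : h = 1 by move=> x; rewrite -rE r1 h1.
apply: support_eq0; rewrite -(return_map_support coU rE) r1.
by apply/seteqP; split=> // x.
Qed.

Lemma irreducibleP h :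
  irreducibles g h <-> clopen (support h) /\ h =1 return_map g (support h).
Proof.
split=> [hA|[coU hU]]; last exact: return_map_irreducible hU.
split; last exact: irreducible_return_map.
by case: hA => /strongly_positive_clopen_support.
Qed.

Lemma irreducible_of_clopen U :
  clopen U -> exists2 h, irreducibles g h & support h = U.
Proof.
move=> coU; have [r rE _] := return_map_homeo coU.
by exists r; [exact: return_map_irreducible rE|exact: return_map_support].
Qed.

Lemma support_inj h1 h2 :
  irreducibles g h1 -> irreducibles g h2 -> support h1 = support h2 -> h1 = h2.
Proof.
move=> /irreducible_return_map e1 /irreducible_return_map e2 s12.
by apply: homeo_eq => x; rewrite e1 e2 s12.
Qed.

(** Commutation makes the intersection of the supports stable under [h1]; it is relatively clopen
    and nonempty, so minimality of [h1] on its own support makes it the whole of that support. *)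
Lemma irreducible_commute_support h1 h2 x :
  irreducibles g h1 -> irreducibles g h2 -> h1 * h2 = h2 * h1 ->
  support h1 x -> support h2 x -> support h1 `<=` support h2.
Proof.
move=> /irreducibleP[co1 e1] /irreducibleP[co2 e2] hC s1 s2.
apply: (@subset_trans _ (support h1 `&` support h2)); last exact: subIsetr.
apply: (return_map_minimal co1 e1); first exact: subIsetl.
- rewrite setDIr setDv set0U setDE.
  by apply: openI; [case: co1|case: co2 => _; exact: closed_openC].
- move=> y [y1 y2]; split; first exact/support_stable.
  exact: commute_stable_support.
- by exists x.
Qed.

Lemma irreducible_commuteP h1 h2 :
  irreducibles g h1 -> irreducibles g h2 ->
  h1 * h2 = h2 * h1 <->
  h1 = h2 \/ (forall x, support h1 x -> ~ support h2 x).
Proof.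
move=> A1 A2; split=> [hC|]; last by case=> [->|] //; exact: commute_disjoint_support.
have [|dis] := pselect (exists2 x, support h1 x & support h2 x); last first.
  by right=> x s1 s2; apply: dis; exists x.
move=> [x s1 s2]; left; apply: support_inj => //; apply/seteqP.
by split; exact: (irreducible_commute_support (x := x)).
Qed.

End MinimalSystem.

(** * The support order as inclusion of supports *)

Lemma compact_opens_clopen (X : topologicalType) (U : set X) :
  compact [set: X] -> hausdorff_space X -> compact_opens U <-> clopen U.
Proof.
move=> cX hX; split=> [[cU oU]|[oU cU]]; split=> //; first exact: compact_closed.
exact: subclosed_compact cU cX _.
Qed.

(** The orbit of a point [x] of [W] returns to [W] at a point [y], distinct from [x] by
    aperiodicity; a basic neighbourhood of [x] inside [W] that avoids [y] is the required set. *)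
Lemma proper_clopen_subset (X : topologicalType) (g : homeo X) (W : set X) :
  compact_minimal_system g -> zero_dimensional_space X -> open W -> W !=set0 ->
  exists V, [/\ clopen V, V !=set0, V `<=` W & V <> W].
Proof.
move=> Xmin [_ base] oW [x Wx]; have [_ cX hX gmin] := Xmin.
have [n Wn] := minimal_recurrent gmin oW (ex_intro _ x Wx) (g x).
set y := iter n g (g x) in Wn.
have xy : x <> y.
  move=> e; suff : n.+1 = 0%N by [].
  by apply: (minimal_aperiodic (x := x) Xmin); rewrite iterSr -/y -e.
have oWy : open (W `\ y).
  rewrite setDE; apply: openI => //; apply: closed_openC.
  exact: (accessible_closed_set1 (hausdorff_accessible hX)).
have [|V [VO Vx] VW] := base x (W `\ y); first by apply: open_nbhs_nbhs.
exists V; split; [exact: (compact_opens_clopen V cX hX).1 VO|by exists x| |].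
- by move=> z /VW[].
- by move=> VWe; have [|_] := VW y; [rewrite VWe|apply].
Qed.

Lemma supp_leP (X : topologicalType) (g h1 h2 : homeo X) :
  compact_minimal_system g -> zero_dimensional_space X ->
  irreducibles g h1 -> irreducibles g h2 ->
  supp_le g h1 h2 <-> support h1 `<=` support h2.
Proof.
move=> Xmin Xzd A1 A2; split=> [le12 x s1|s12 a [Aa aC]].
  have [[oU1 cU1] _] := (irreducibleP Xmin h1).1 A1.
  have [[oU2 cU2] _] := (irreducibleP Xmin h2).1 A2.
  apply: contrapT => s2; pose W := support h1 `\` support h2.
  have oW : open W by rewrite /W setDE; apply: openI => //; exact: closed_openC.
  have [|V [coV [v Vv] VW VWne]] := proper_clopen_subset Xmin Xzd oW.
    by exists x.
  (* The test element [a] commutes with [h2] because their supports are disjoint. It cannot commute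
     with [h1]: its support meets that of [h1], and properness of [V] in [W] rules out [a = h1]. *)
  have [a Aa aV] := irreducible_of_clopen Xmin coV.
  have [|[_ /(irreducible_commuteP Xmin Aa A1)[]]|] := le12 a.
  - split=> //; apply: commute_disjoint_support => y; rewrite aV.
    by move=> /VW[].
  - move=> a1; apply: VWne; apply/seteqP; split=> // y [].
    by rewrite -a1 aV.
  - by move=> /(_ v); rewrite aV => /(_ Vv); apply; have [] := VW _ Vv.
  - by move=> /= a2; have [_] := VW _ Vv; apply; rewrite -a2 aV.
(* The case [a = h2] is absorbed by the singleton in the definition of the order; otherwise
   disjointness from the larger support passes to the smaller one. *)
have [a2|dis] := (irreducible_commuteP Xmin Aa A2).1 aC; first by right.
left; split=> //; apply: commute_disjoint_support => x ax /s12.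
exact: dis.
Qed.

(** * Conjugation by elements commuting with [g] *)

Lemma conj_by_mul (G : groupType) (k a b : G) :
  conj_by k (a * b) = conj_by k a * conj_by k b.
Proof. by rewrite /conj_by !mulgA mulgVK. Qed.

Lemma conj_byVK (G : groupType) (k : G) : cancel (conj_by k^-1) (conj_by k).
Proof. by move=> a; rewrite /conj_by invgK !mulgA mulgV mul1g mulgK. Qed.

Lemma conj_byK (G : groupType) (k : G) : cancel (conj_by k) (conj_by k^-1).
Proof. by move=> a; rewrite -{2}[k]invgK conj_byVK. Qed.

Lemma conj_by1 (G : groupType) (k : G) : conj_by k 1 = 1.
Proof. by rewrite /conj_by mulg1 mulgV. Qed.

Lemma indecomposable_conj (G : groupType) (M : set G) (k h : G) :
  (forall a, M a -> M (conj_by k a)) ->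
  (forall a, M a -> M (conj_by k^-1 a)) ->
  indecomposable M h -> indecomposable M (conj_by k h).
Proof.
move=> Mk MkV [Mh hirr]; split; first exact: Mk.
move=> [a [b [[Ma a1] [Mb b1] e]]]; apply: hirr.
exists (conj_by k^-1 a), (conj_by k^-1 b).
have ne1 c : ~ [set 1] c -> ~ [set 1] (conj_by k^-1 c).
  by move=> c1 /(congr1 (conj_by k)); rewrite conj_byVK conj_by1.
split; [by split; [exact: MkV|exact: ne1]..|].
by rewrite -conj_by_mul -e conj_byK.
Qed.

Lemma expgz_commute (G : groupType) (g : G) (n : int) : commute (expgz g n) g.
Proof.
case: n => n /=; apply/commute_sym; first exact: commuteX.
exact/commuteV/commuteX.
Qed.

Lemma homeo_commute_iter (X : topologicalType) (k g : homeo X) (n : nat) (x : X) :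
  commute k g -> k (iter n g x) = iter n g (k x).
Proof.
by move=> kg; rewrite -!homeo_expE -!homeo_mulE (commuteX n kg).
Qed.

(** Since [k] commutes with the iterates of [g], the conjugate has as cocycle that of [h] composed
    with the inverse of [k]. *)
Lemma strongly_positive_conj (X : topologicalType) (g k h : homeo X) :
  compact_minimal_system g -> commute k g ->
  strongly_positive g h -> strongly_positive g (conj_by k h).
Proof.
move=> Xmin kg /(strongly_positiveP Xmin)[c lc hc].
apply/(strongly_positiveP Xmin).
exists (fun x => c (homeo_inv k x)) => x.
  by apply: near_comp (lc _); exact: homeo_inv_continuous.
rewrite /conj_by !homeo_mulE homeo_invE hc homeo_commute_iter//.
by rewrite homeo_invK.
Qed.

Lemma irreducibles_conj (X : topologicalType) (g k h : homeo X) :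
  compact_minimal_system g -> commute k g ->
  irreducibles g h -> irreducibles g (conj_by k h).
Proof.
move=> Xmin kg; apply: indecomposable_conj => a; apply: strongly_positive_conj => //.
exact/commute_sym/commuteV/commute_sym.
Qed.

Unset Implicit Arguments.

Theorem proposition6p1 (X : topologicalType) (g : homeo X)
    (Xmin : compact_minimal_system g) (Xzd : zero_dimensional_space X) :
  [/\ is_boolean_algebra (irreducibles g) (supp_le g) 1 g,
      (forall k : homeo X, cyclic_subgroup g k ->
         set_bij (irreducibles g) (irreducibles g) (conj_by k) /\
         forall h1 h2 : homeo X, irreducibles g h1 -> irreducibles g h2 ->
           (supp_le g (conj_by k h1) (conj_by k h2) <-> supp_le g h1 h2))
    & exists phi : homeo X -> set X,
        [/\ set_bij (irreducibles g) (@compact_opens X) phi,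
            (forall h1 h2 : homeo X, irreducibles g h1 -> irreducibles g h2 ->
               (supp_le g h1 h2 <-> phi h1 `<=` phi h2))
          & forall k h : homeo X, cyclic_subgroup g k -> irreducibles g h ->
              phi (conj_by k h) = k @` phi h]].
Proof.
have [_ cX hX _] := Xmin.
have leP h1 h2 : irreducibles g h1 -> irreducibles g h2 ->
    supp_le g h1 h2 <-> support h1 `<=` support h2 by exact: supp_leP.
have coP (U : set X) : compact_opens U <-> clopen U by exact: compact_opens_clopen.
have bij : set_bij (irreducibles g) (@compact_opens X) (@support X).
  split=> [h /(irreducibleP Xmin h)[coU _]|h1 h2|U /coP coU]; first exact/coP.
    by rewrite !inE; exact: support_inj.
  by have [h Ah <-] := irreducible_of_clopen Xmin coU; exists h.
have comm k : cyclic_subgroup g k -> commute k g.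
  by move=> [n _ <-]; exact: expgz_commute.
split; last by exists (@support X); split=> // k h _ _; exact: support_conj.
- have s1 : support (1 : homeo X) = set0 by apply/seteqP; split=> x // /(_ erefl).
  have sg : support g = setT.
    apply/seteqP; split=> x // _ gx; suff : 1%N = 0%N by [].
    exact: (minimal_aperiodic (x := x) Xmin).
  apply: (is_boolean_algebra_set_bij bij) => //.
  + by apply/coP; split; [exact: open0|exact: closed0].
  + move=> U /coP[oU cU]; apply/coP.
    by split; [exact: closed_openC|exact: open_closedC].
  + move=> U V /coP[oU cU] /coP[oV cV].
    by apply/coP; split; [exact: openI|exact: closedI].
  (* The identity is the return map to the empty set. *)
  + apply/(irreducibleP Xmin); rewrite s1; split.
      by split; [exact: open0|exact: closed0].
    by move=> x; rewrite /return_map first_return_out.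
  (* The homeomorphism [g] is the return map to the whole space, with constant return time 1. *)
  + apply/(irreducibleP Xmin); rewrite sg; split.
      by split; [exact: openT|exact: closedT].
    move=> x; rewrite /return_map (@first_returnE _ _ _ _ 1%N)//.
    by split=> // -[|i].
- move=> k /comm kg.
  have kVg : commute k^-1 g by exact/commute_sym/commuteV/commute_sym.
  have Ak h : irreducibles g h -> irreducibles g (conj_by k h).
    exact: irreducibles_conj.
  split.
    split=> [|h1 h2 _ _|h Ah]; first exact: Ak.
      exact: (can_inj (@conj_byK _ k)).
    exists (conj_by k^-1 h); last exact: conj_byVK.
    exact: irreducibles_conj.
  (* Both orders become inclusions of supports; conjugation replaces supports by their images under
     the injective map [k], which preserves and reflects inclusion. *)
  move=> h1 h2 A1 A2; rewrite leP; [|exact: Ak..].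
  rewrite leP// !support_conj; split=> s12 x; last first.
    by move=> [y s1 <-]; exists y => //; exact: s12.
  move=> s1; have [|y s2 /homeo_inj <- //] := s12 (k x).
  by exists x.
Qed.
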